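(* Let $Y$ be a real valued random variable, $\mathbf{X}=(X_i)_{i\in\mathbb{N}}$ a sequence of real valued random variables, and $Z$ a random variable with values in a Borel space $(E,\mathcal{E})$. Let $i\in\mathbb{N}$. Assume: (A1) For each $j\in\mathbb{N}$ a Markov kernel $(P^j_{x,\mathbf{x}})_{(x,\mathbf{x})\in\mathbb{R}\times\mathbb{R}^{\mathbb{N}}}$ on $\mathbb{R}$ is fixed, which is a regular conditional distribution of $Y$ given $(X_j,\mathbf{X}_{-j})=(x,\mathbf{x})$, and $\iint|y|\,P^j_{x,\mathbf{x}}(\mathrm{d}y)\,P^{-j}(\mathrm{d}\mathbf{x})<\infty$ for all $x\in\mathbb{R}$, where $P^{-j}$ is the distribution of $\mathbf{X}_{-j}$. (A2) $X_1,X_2,\ldots$ are conditionally independent given $Z$, and $\sigma(Z)\subseteq\bigcap_{j=1}^\infty\sigma(\mathbf{X}_{-j})$. (A3) $\mathbb{E}[Y^2]<\infty$, $\mathbb{E}[X_i^2]<\infty$ and $\mathbb{E}[\mathrm{Var}[X_i\mid Z]]>0$. Let $b^i_x(z)$ be the regression function and $\beta_i$ the target parameter defined in the context. Then $$\beta_i=\frac{\mathbb{E}\big[\mathrm{Cov}[X_i,b^i_{X_i}(Z)\mid Z]\big]}{\mathbb{E}\big[\mathrm{Var}[X_i\mid Z]\big]}.$$ Moreover, $\beta_i=0$ if $b^i_x(z)$ does not depend on $x$. If $b^i_x(z)=\beta_i'(z)x+\Gamma_{-i}(z)$ for functions $\beta_i',\Gamma_{-i}:E\to\mathbb{R}$,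 then $$\beta_i=\mathbb{E}[w_i(Z)\beta_i'(Z)],\qquad\text{where}\quad w_i(Z)=\frac{\mathrm{Var}[X_i\mid Z]}{\mathbb{E}[\mathrm{Var}[X_i\mid Z]]}.$$
   Context: $\mathbf{X}_{-i}=(X_j)_{j\in\mathbb{N}\setminus\{i\}}$, regarded as taking values in $\mathbb{R}^{\mathbb{N}}$ (identified with $\mathbb{R}^{\mathbb{N}\setminus\{i\}}$); $\mathbb{R}$ carries the Borel $\sigma$-algebra and $\mathbb{R}^{\mathbb{N}}$ the product $\sigma$-algebra. Let $P^{-i}_z$ be a regular conditional distribution of $\mathbf{X}_{-i}$ given $Z=z$ and $$Q^i_{x,z}(A)=\int P^i_{x,\mathbf{x}}(A)\,P^{-i}_z(\mathrm{d}\mathbf{x}),$$ which is a regular conditional distribution of $Y$ given $(X_i,Z)=(x,z)$. The regression function is $$b^i_x(z)=\int y\,Q^i_{x,z}(\mathrm{d}y)=\mathbb{E}[Y\mid X_i=x;Z=z].$$ The target parameter is $$\beta_i=\frac{\mathbb{E}\big[\mathrm{Cov}[X_i,Y\mid Z]\big]}{\mathbb{E}\big[\mathrm{Var}[X_i\mid Z]\big]}.$$ *)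

(* Defs.v *)
From HB Require Import structures.
From mathcomp Require Import all_boot all_order all_algebra finmap.
From mathcomp Require Import all_classical all_reals all_analysis measurable_realfun.

Set Implicit Arguments.
Unset Strict Implicit.
Unset Printing Implicit Defensive.
Import Order.TTheory GRing.Theory Num.Theory.
Import numFieldNormedType.Exports.

Local Open Scope classical_set_scope.
Local Open Scope ring_scope.
Local Open Scope ereal_scope.

(* Isomorphic, as a measurable space, to a Borel subset of the real line. *)
Definition borel_space (R : realType) d (E : measurableType d) : Prop :=
  exists (B : set R) (f : E -> R) (g : R -> E),
    [/\ measurable B, measurable_fun setT f & measurable_fun B g] /\
    [/\ forall z, B (f z), cancel f g & forall r, B r -> f (g r) = r].

Definition coordinate_sets (R : realType) : set (set (nat -> R)) :=
  [set A | exists (n : nat) (B : set R),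
    measurable B /\ A = (fun u : nat -> R => u n) @^-1` B].
Arguments coordinate_sets R : clear implicits.

(* Sequences of reals with the product sigma-algebra. *)
Definition realseq (R : realType) :
    measurableType (sigma_display (coordinate_sets R)) :=
  g_sigma_algebraType (coordinate_sets R).

Section remove_coordinate.
Context d (T : measurableType d) (R : realType).

(* [bump i] is the increasing enumeration of nat minus [i]; it identifies
   sequences indexed by nat minus [i] with sequences indexed by nat. *)
Definition drop_coord (X : nat -> {mfun T >-> R}) (i : nat) : T -> realseq R :=
  fun w k => X (bump i k) w.

Variables (X : nat -> {mfun T >-> R}) (i : nat).

Let measurable_drop_coord : measurable_fun setT (drop_coord X i).
Proof.
apply: (@measurability _ _ T (realseq R) setT _ (coordinate_sets R)) => //.
move=> _ [_ [n [B [mB ->]]] <-].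
by rewrite setTI; exact: (measurable_funPTI (X (bump i n))).
Qed.

HB.instance Definition _ :=
  isMeasurableFun.Build _ _ _ _ (drop_coord X i) measurable_drop_coord.

Definition split_coord : T -> R * realseq R :=
  fun w => (X i w, drop_coord X i w).

End remove_coordinate.

Section conditional_expectation.
Context d (T : measurableType d) (R : realType) (P : probability T R).
Context d' (S : measurableType d') (W : T -> S).

Definition is_cond_exp (F U : T -> R) : Prop :=
  [/\ P.-integrable setT (EFin \o F),
      P.-integrable setT (EFin \o U),
      measurable_fun (setT : set (g_sigma_algebra_preimageType W)) U &
      forall A, g_sigma_algebra_preimage W A ->
        \int[P]_(w in A) (U w)%:E = \int[P]_(w in A) (F w)%:E].

(* A fixed version of E[F | W], equal to 0 by convention if there is none. *)
Definition cond_exp (F : T -> R) : T -> R :=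
  xget (cst 0%R) [set U | is_cond_exp F U].

Definition cond_prob (A : set T) : T -> R := cond_exp (\1_A).

Definition cond_cov (F G : T -> R) : T -> R :=
  cond_exp (fun w => (F w - cond_exp F w) * (G w - cond_exp G w))%R.

Definition cond_var (F : T -> R) : T -> R :=
  cond_exp (fun w => (F w - cond_exp F w) ^+ 2)%R.

Definition cond_independent (X : nat -> {mfun T >-> R}) : Prop :=
  forall (J : {fset nat}) (B : nat -> set R),
    (forall j, measurable (B j)) ->
    {ae P, forall w,
      cond_prob (\bigcap_(j in [set` J]) (X j @^-1` B j)) w =
      (\prod_(j <- J) cond_prob (X j @^-1` B j) w)%R}.

Definition is_reg_cond_dist d2 (S2 : measurableType d2) (V : T -> S2)
    (k : R.-pker S ~> S2) : Prop :=
  forall B : set S2, measurable B ->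
    is_cond_exp (\1_(V @^-1` B)) (fun w => fine (k (W w) B)).

End conditional_expectation.

Section mixed_kernel.
Context (R : realType) d (E : measurableType d).
Variables (Pi : R.-pker (R * realseq R)%type ~> R).
Variables (Pmi : R.-pker E ~> realseq R) (x : R) (z : E).

Definition mixed_kernel (A : set R) : \bar R := \int[Pmi z]_u Pi (x, u) A.

Let mixed_kernel0 : mixed_kernel set0 = 0.
Proof.
by rewrite /mixed_kernel (eq_integral (cst 0)) ?integral0// => u _;
  rewrite measure0.
Qed.

Let mixed_kernel_ge0 A : 0 <= mixed_kernel A. Proof. exact: integral_ge0. Qed.

Let mixed_kernel_sigma_additive : semi_sigma_additive mixed_kernel.
Proof.
move=> U mU tU mUU; rewrite [X in _ --> X](_ : _ =
  \int[Pmi z]_u (\sum_(n <oo) Pi (x, u) (U n))); last first.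
  apply: eq_integral => u _.
  by apply/esym/cvg_lim => //; exact/measure_semi_sigma_additive.
apply/cvg_closeP; split.
  by apply: is_cvg_nneseries => n _ _; exact: integral_ge0.
rewrite closeE// integral_nneseries// => n.
exact: measurableT_comp (measurable_kernel Pi _ (mU n)) _.
Qed.

HB.instance Definition _ := isMeasure.Build _ _ _ mixed_kernel
  mixed_kernel0 mixed_kernel_ge0 mixed_kernel_sigma_additive.

(* Being a [Rintegral], this is 0 where the mean is infinite or undefined. *)
Definition regression : R := (\int[mixed_kernel]_y y)%R.

End mixed_kernel.

Section target.
Context d (T : measurableType d) (R : realType) (P : probability T R).
Context d' (E : measurableType d').

Definition target (Z : T -> E) (F G : T -> R) : R :=
  (fine 'E_P[cond_cov P Z F G] / fine 'E_P[cond_var P Z F])%R.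

End target.

(* Main.v *)
Require Import Defs.
From HB Require Import structures.
From mathcomp Require Import all_boot all_order all_algebra finmap.
From mathcomp Require Import all_classical all_reals all_analysis measurable_realfun.
From mathcomp Require Import ring.

Set Implicit Arguments.
Unset Strict Implicit.
Unset Printing Implicit Defensive.
Import Order.TTheory GRing.Theory Num.Theory.
Import numFieldNormedType.Exports.

Local Open Scope classical_set_scope.
Local Open Scope ring_scope.
Local Open Scope ereal_scope.

(** Throughout, conditioning on a map means conditioning on the sigma-algebra
it generates, and a version of a conditional expectation is any function [U]
with [is_cond_exp P W F U].

The heart of the matter is that [B = b(X_i, Z)] is a version of
[E[Y | X_i, Z]] ([regression_is_cond_exp]). Given [(X_i, Z)], the remaining
coordinates [X_{-i}] are distributed according to [Pmi Z]: on products of a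
box in the values of [(X_i, Z)] with a finite-dimensional cylinder this is the
conditional independence of the coordinates given [Z]
([cond_independent_boxes]), and such products generate the product
sigma-algebra and are closed under intersection, so the law of
[((X_i, Z), X_{-i})] is determined by them ([disintegration],
[joint_integral]). On the other hand [Y] is distributed according to
[P^i_{X_i, X_{-i}}] given all coordinates, and an event about [(X_i, Z)] is an
event about the coordinates because [sigma(Z)] is contained in
[sigma(X_{-i})]. Averaging the second kernel over the first one gives
[Q^i_{X_i, Z}] as the conditional distribution of [Y] given [(X_i, Z)]
([response_integral]), whose mean is [B].

Once this is known, the three claims are about [L^2]. Since [sigma(Z)] is
coarser than [sigma(X_i, Z)], [Y] and [B] have the same conditional expectation
given [Z]; since [X_i - E[X_i | Z]] is a function of [(X_i, Z)], pulling it out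
of the conditional expectation shows that [Y] and [B] have the same
conditional covariance with [X_i] given [Z] ([cond_cov_tower]). If
[B = beta'(Z) X_i + Gamma(Z)], then [B - E[B | Z]] is
[beta'(Z) (X_i - E[X_i | Z])], and pulling out [beta'(Z)] turns the
expected conditional covariance into [E[beta'(Z) Var[X_i | Z]]]
([cond_cov_affine]); neither [beta'(Z) X_i] nor [Gamma(Z)] has to be
integrable for this, which is why both are first damped by a positive weight.
A regression function that is constant in [x] is the case [beta' = 0].

Conditional expectations exist by the Radon-Nikodym theorem
([is_cond_exp_exists]). That multiplying by a function measurable for the
sub-sigma-algebra keeps integrability ([is_cond_expM]) rests on one observation:
if the integrals of [f] are at most those of [g] over all events of the
sub-sigma-algebra, then this remains true after multiplication by any
nonnegative function measurable for it ([ge0_le_pullout]). *)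

(** * Induction on nonnegative measurable functions *)

Section ge0_measurable_ind.
Import HBNNSimple.

(** The standard machine of integration theory as an induction principle: every
nonnegative measurable function is the increasing limit of simple functions. *)
Lemma ge0_measurable_ind d (T : measurableType d) (R : realType)
    (Q : (T -> \bar R) -> Prop) :
  (forall A, measurable A -> Q (fun x => (\1_A x)%:E)) ->
  (forall (c : R) f, (0 <= c)%R -> measurable_fun setT f ->
    (forall x, 0 <= f x) -> Q f -> Q (fun x => c%:E * f x)) ->
  (forall f g, measurable_fun setT f -> (forall x, 0 <= f x) -> Q f ->
    measurable_fun setT g -> (forall x, 0 <= g x) -> Q g ->
    Q (fun x => f x + g x)) ->
  (forall f : (T -> \bar R)^nat, (forall n, measurable_fun setT (f n)) ->
    (forall n x, 0 <= f n x) ->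
    (forall x, {homo f ^~ x : m n / (m <= n)%N >-> m <= n}) ->
    (forall n, Q (f n)) -> Q (fun x => limn (f ^~ x))) ->
  forall f, measurable_fun setT f -> (forall x, 0 <= f x) -> Q f.
Proof.
move=> Qi QZ QD Ql f mf f0.
pose g := nnsfun_approx measurableT mf.
have -> : f = fun x => limn (fun n => (g n x)%:E).
  apply/funext => x; apply/esym/cvg_lim => //.
  by apply: cvg_nnsfun_approx.
apply: (Ql (fun n x => (g n x)%:E)) => [n|n x|x m n mn|n].
- exact/measurable_EFinP.
- by rewrite lee_fin.
- by rewrite lee_fin; exact/lefP/nd_nnsfun_approx.
have -> : (fun x => (g n x)%:E) = (fun x => (\sum_(y <- fset_set (range (g n)))
    (y * \1_(g n @^-1` [set y]) x)%R)%:E).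
  by apply/funext => x; rewrite fimfunE fsbig_finite.
have : forall y, y \in enum_fset (fset_set (range (g n))) -> (0 <= y)%R.
  move=> y; rewrite -[_ \in _]/(y \in fset_set (range (g n))).
  by rewrite in_fset_set// inE => -[x _ <-].
have mg (y : R) : measurable (g n @^-1` [set y]).
  by apply: measurable_funPTI; exact: measurable_set1.
elim: (enum_fset _) => [_|y s IH ys].
  have -> : (fun x => (\sum_(y <- [::]) (y * \1_(g n @^-1` [set y]) x)%R)%:E)
      = fun x => (\1_(set0 : set T) x)%:E.
    by apply/funext => x; rewrite big_nil indic0.
  exact: Qi.
have y0 : (0 <= y)%R by apply: ys; rewrite mem_head.
have -> : (fun x => (\sum_(y <- y :: s) (y * \1_(g n @^-1` [set y]) x)%R)%:E) =
    fun x => y%:E * (\1_(g n @^-1` [set y]) x)%:E +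
      (\sum_(y <- s) (y * \1_(g n @^-1` [set y]) x)%R)%:E.
  by apply/funext => x; rewrite big_cons EFinD EFinM.
have s0 z : z \in s -> (0 <= z)%R by move=> zs; apply: ys; rewrite in_cons zs orbT.
apply: QD => //.
- by apply: measurable_funeM; exact/measurable_EFinP.
- by move=> x; rewrite mule_ge0 ?lee_fin.
- apply: (QZ y (fun x => (\1_(g n @^-1` [set y]) x)%:E));
    [exact: y0| | |exact: (Qi _ (mg y))].
  + exact/measurable_EFinP.
  + by move=> x; rewrite lee_fin.
- apply/measurable_EFinP; apply: measurable_sum => z.
  by apply: measurable_funM.
- move=> x; rewrite lee_fin big_seq; apply: sumr_ge0 => z zs.
  by rewrite mulr_ge0// s0.
- exact: IH.
Qed.

End ge0_measurable_ind.

(** * The sigma-algebra generated by a map *)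

Section sub_sigma_algebra.
Context d (T : measurableType d) d' (S : measurableType d').
Variable W : T -> S.
Hypothesis mW : measurable_fun setT W.

Local Notation TW := (g_sigma_algebra_preimageType W).

Lemma preimage_sigma_algebra_sub :
  g_sigma_algebra_preimage W `<=` measurable.
Proof. by move=> _ [B mB <-]; exact: mW. Qed.

Lemma measurable_fun_sub_sigma_algebra d2 (T2 : measurableType d2) (f : T -> T2) :
  measurable_fun (setT : set TW) f -> measurable_fun setT f.
Proof.
by move=> mf mT B mB; apply: preimage_sigma_algebra_sub; exact: mf.
Qed.

Lemma measurable_comp_preimage_sigma_algebra d2 (T2 : measurableType d2)
    (f : S -> T2) :
  measurable_fun setT f -> measurable_fun (setT : set TW) (f \o W).
Proof.
move=> mf mT B mB; exists (f @^-1` B); last by rewrite comp_preimage.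
by rewrite -[X in measurable X]setTI; exact: mf.
Qed.

End sub_sigma_algebra.

Lemma measurable_fun_sigma_algebra_mono d (T : measurableType d)
    d1 (S1 : measurableType d1) d2 (S2 : measurableType d2) (V : T -> S1)
    (W : T -> S2) d3 (T3 : measurableType d3) (f : T -> T3) :
  g_sigma_algebra_preimage V `<=` g_sigma_algebra_preimage W ->
  measurable_fun (setT : set (g_sigma_algebra_preimageType V)) f ->
  measurable_fun (setT : set (g_sigma_algebra_preimageType W)) f.
Proof. by move=> VW mf mT B mB; apply: VW; exact: mf. Qed.

Section ge0_pullout.
Context d (T : measurableType d) (R : realType) (P : probability T R).
Context d' (S : measurableType d') (W : T -> S).
Hypothesis mW : measurable_fun setT W.
Local Notation TW := (g_sigma_algebra_preimageType W).

(** The hypothesis is the case of an indicator function [K], from which the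
general case follows by additivity and monotone convergence. *)
Lemma ge0_le_pullout (f g : T -> R) (K : T -> \bar R) :
  measurable_fun setT f -> (forall x, 0 <= f x)%R ->
  measurable_fun setT g -> (forall x, 0 <= g x)%R ->
  (forall A, g_sigma_algebra_preimage W A ->
    \int[P]_(x in A) (f x)%:E <= \int[P]_(x in A) (g x)%:E) ->
  measurable_fun (setT : set TW) K -> (forall x, 0 <= K x) ->
  \int[P]_x (K x * (f x)%:E) <= \int[P]_x (K x * (g x)%:E).
Proof.
move=> /measurable_EFinP mf f0 /measurable_EFinP mg g0 fg mK K0.
pose Q (K : TW -> \bar R) := \int[P]_x (K x * (f x)%:E) <= \int[P]_x (K x * (g x)%:E).
have mWT (h : TW -> \bar R) : measurable_fun setT h ->
    measurable_fun (setT : set T) h.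
  exact: measurable_fun_sub_sigma_algebra.
have mM (h : TW -> \bar R) (u : T -> R) : measurable_fun setT h ->
    measurable_fun setT (EFin \o u) ->
    measurable_fun (setT : set T) (fun x => h x * (u x)%:E).
  by move=> mh mu; apply: emeasurable_funM => //; exact: mWT.
have M0 (h : TW -> \bar R) (u : T -> R) : (forall x, 0 <= h x) ->
    (forall x, 0 <= u x)%R -> forall x : T, setT x -> 0 <= h x * (u x)%:E.
  by move=> h0 u0 x _; apply: mule_ge0 => //; rewrite lee_fin.
apply: (@ge0_measurable_ind _ TW R Q) mK K0; rewrite /Q.
- move=> A mA; have mA' := preimage_sigma_algebra_sub mW mA.
  have E h : \int[P]_x ((\1_A x)%:E * h x) = \int[P]_(x in A) h x.
    by rewrite [RHS]integral_mkcond; apply: eq_integral => x _;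
       rewrite epatch_indic muleC.
  by rewrite !E; exact: fg.
- move=> c h c0 mh h0 H.
  under eq_integral do rewrite -muleA.
  under [leRHS]eq_integral do rewrite -muleA.
  rewrite !ge0_integralZl_EFin//; [|exact: M0|exact: mM|exact: M0|exact: mM].
  by apply: lee_wpmul2l; rewrite ?lee_fin.
- move=> h k mh h0 H mk k0 K'.
  under eq_integral do rewrite ge0_muleDl//.
  under [leRHS]eq_integral do rewrite ge0_muleDl//.
  rewrite !ge0_integralD//;
    by [exact: leeD|exact: M0|exact: mM].
- move=> h mh h0 ndh H.
  have E (u : T -> R) : measurable_fun setT (EFin \o u) ->
      (forall x, 0 <= u x)%R -> \int[P]_x (limn (h ^~ x) * (u x)%:E) =
      limn (fun n => \int[P]_x (h n x * (u x)%:E)).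
    move=> mu u0; rewrite -monotone_convergence//.
    + apply: eq_integral => x _; apply/esym/cvg_lim => //.
      by apply: cvgeZr => //; exact: ereal_nondecreasing_is_cvgn.
    + by move=> n; exact: mM.
    + by move=> n; exact: M0.
    + by move=> x _ m n mn; apply: lee_wpmul2r; rewrite ?lee_fin//; exact: ndh.
  have cE (u : T -> R) : measurable_fun setT (EFin \o u) ->
      (forall x, 0 <= u x)%R -> cvgn (fun n => \int[P]_x (h n x * (u x)%:E)).
    move=> mu u0; apply: ereal_nondecreasing_is_cvgn => m n mn.
    apply: ge0_le_integral => //.
    + exact: M0.
    + exact: mM.
    + exact: mM.
    + by move=> x _; apply: lee_wpmul2r; rewrite ?lee_fin//; exact: ndh.
  rewrite !E//; apply: lee_lim; [exact: cE|exact: cE|exact: nearW].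
Qed.

End ge0_pullout.

(** * Conditional expectations: contraction, uniqueness, pull-out *)

Section conditional_expectation_theory.
Context d (T : measurableType d) (R : realType) (P : probability T R).
Context d' (S : measurableType d') (W : T -> S).
Hypothesis mW : measurable_fun setT W.
Local Notation TW := (g_sigma_algebra_preimageType W).
Implicit Types F G U V k : T -> R.

Let sub_measurable A : g_sigma_algebra_preimage W A -> measurable A.
Proof. exact: preimage_sigma_algebra_sub. Qed.

Let sub_measurable_fun U : measurable_fun (setT : set TW) U ->
  measurable_fun setT U.
Proof. exact: measurable_fun_sub_sigma_algebra. Qed.

Let integrable_sub F A : g_sigma_algebra_preimage W A ->
  P.-integrable setT (EFin \o F) -> P.-integrable A (EFin \o F).
Proof.
by move=> mA; apply: integrableS => //; exact: sub_measurable.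
Qed.

Lemma is_cond_exp_refl U : P.-integrable setT (EFin \o U) ->
  measurable_fun (setT : set TW) U -> is_cond_exp P W U U.
Proof. by []. Qed.

Lemma is_cond_expD F G U V : is_cond_exp P W F U -> is_cond_exp P W G V ->
  is_cond_exp P W (fun w => F w + G w)%R (fun w => U w + V w)%R.
Proof.
move=> [iF iU mU UF] [iG iV mV VG]; split.
- exact: (integrableD measurableT iF iG).
- exact: (integrableD measurableT iU iV).
- exact: measurable_funD.
move=> A mA; under eq_integral do rewrite EFinD.
under [RHS]eq_integral do rewrite EFinD.
by rewrite !integralD_EFin ?UF ?VG//;
  solve [exact: integrable_sub|exact: sub_measurable].
Qed.

Lemma is_cond_expB F G U V : is_cond_exp P W F U -> is_cond_exp P W G V ->
  is_cond_exp P W (fun w => F w - G w)%R (fun w => U w - V w)%R.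
Proof.
move=> [iF iU mU UF] [iG iV mV VG]; split.
- exact: (integrableB measurableT iF iG).
- exact: (integrableB measurableT iU iV).
- exact: measurable_funB.
move=> A mA; under eq_integral do rewrite EFinB.
under [RHS]eq_integral do rewrite EFinB.
by rewrite !integralB_EFin ?UF ?VG//;
  solve [exact: integrable_sub|exact: sub_measurable].
Qed.

(** On an event of the sub-sigma-algebra where [U] has constant sign, the
integral of [`|U|] is the absolute value of that of [U], which is that of [F];
and [A] splits into two such events. *)
Lemma cond_exp_contraction F U A : is_cond_exp P W F U ->
  g_sigma_algebra_preimage W A ->
  \int[P]_(w in A) `|U w|%:E <= \int[P]_(w in A) `|F w|%:E.
Proof.
move=> [iF iU mU UF] mA.
have sgn B : g_sigma_algebra_preimage W B ->
    (forall w, B w -> 0 <= U w)%R \/ (forall w, B w -> U w <= 0)%R ->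
    \int[P]_(w in B) `|U w|%:E <= \int[P]_(w in B) `|F w|%:E.
  move=> mB Usgn; have mB' := sub_measurable mB.
  have -> : \int[P]_(w in B) `|U w|%:E = `| \int[P]_(w in B) (U w)%:E |.
    case: Usgn => Usgn.
      rewrite gee0_abs; last by apply: integral_ge0 => w /Usgn; rewrite lee_fin.
      by apply: eq_integral => w; rewrite inE => /Usgn Uw; rewrite ger0_norm.
    have E : \int[P]_(w in B) (U w)%:E = - \int[P]_(w in B) `|U w|%:E.
      rewrite -integral_ge0N//.
      apply: eq_integral => w; rewrite inE => /Usgn Uw.
      by rewrite ler0_norm// EFinN oppeK.
    by rewrite E abseN gee0_abs//; exact: integral_ge0.
  rewrite UF//; apply: le_trans (le_abse_integral _ _ _) _ => //.
  exact: measurable_int (integrable_sub mB iF).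
have mN : g_sigma_algebra_preimage W [set w | U w < 0]%R.
  rewrite (_ : [set _ | _] = U @^-1` `]-oo, 0%R[); last first.
    by apply/seteqP; split=> w; rewrite /= in_itv.
  by rewrite -[X in g_sigma_algebra_preimage W X]setTI; exact: mU.
have mAN : g_sigma_algebra_preimage W (A `&` [set w | U w < 0]%R).
  exact: (@measurableI _ TW).
have mAD : g_sigma_algebra_preimage W (A `\` [set w | U w < 0]%R).
  exact: (@measurableD _ TW).
have AE : A = (A `&` [set w | U w < 0]%R) `|` (A `\` [set w | U w < 0]%R).
  by rewrite setUIDK.
have Adisj : [disjoint A `&` [set w | (U w < 0)%R] & A `\` [set w | (U w < 0)%R]].
  by apply/disj_setPS => w [[_ +] [_]].
have split_int H : P.-integrable setT (EFin \o H) ->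
    \int[P]_(w in A) `|H w|%:E =
    \int[P]_(w in A `&` [set w | U w < 0]%R) `|H w|%:E +
    \int[P]_(w in A `\` [set w | U w < 0]%R) `|H w|%:E.
  move=> iH; rewrite {1}AE ge0_integral_setU//; try exact: sub_measurable.
  apply: measurable_funTS; apply/measurable_EFinP.
  by apply: measurableT_comp => //; apply/measurable_EFinP/(measurable_int _ iH).
rewrite !split_int//; apply: leeD; apply: sgn => //.
- by right=> w [_ /ltW].
- by left=> w [_ /negP]; rewrite -leNgt.
Qed.

(** [U - V] is a version of the conditional expectation of [0], hence vanishes
in [L^1] by contraction. *)
Lemma cond_exp_unique F U V : is_cond_exp P W F U -> is_cond_exp P W F V ->
  {ae P, forall w, U w = V w}.
Proof.
move=> FU FV; have FUV := is_cond_expB FU FV.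
have mUV : measurable_fun setT (EFin \o (fun w => U w - V w)%R).
  by case: FUV => _ iUV _ _; exact: measurable_int iUV.
have : \int[P]_w `|(U w - V w)%:E| = 0.
  apply/eqP; rewrite eq_le; apply/andP; split; last exact: integral_ge0.
  apply: le_trans (@cond_exp_contraction _ _ setT FUV _) _.
    exact: (@measurableT _ TW).
  by rewrite integral0_eq// => w _; rewrite subrr normr0.
move/(ae_eq_integral_abs P measurableT mUV).
by apply: filterS => w /(_ I) [] /eqP; rewrite subr_eq0 => /eqP.
Qed.

(** The pull-out property, where only [k * F] is required to be integrable:
contraction against the weight [`|k|] makes [k * U] integrable as well. *)
Lemma is_cond_expM k F U : is_cond_exp P W F U ->
  measurable_fun (setT : set TW) k ->
  P.-integrable setT (EFin \o (fun w => k w * F w)%R) ->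
  is_cond_exp P W (fun w => k w * F w)%R (fun w => k w * U w)%R.
Proof.
move=> FU mk ikF; have [iF iU mU UF] := FU.
have mk' := sub_measurable_fun mk; have mU' := sub_measurable_fun mU.
have mF' : measurable_fun setT F by apply/measurable_EFinP/(measurable_int _ iF).
have ikU : P.-integrable setT (EFin \o (fun w => k w * U w)%R).
  apply/integrableP; split; first exact/measurable_EFinP/measurable_funM.
  case/integrableP : ikF => _; apply: le_lt_trans.
  have E (H : T -> R) : \int[P]_w `|(EFin \o (fun w => k w * H w)%R) w| =
      \int[P]_w (`|k w|%:E * `|H w|%:E).
    by apply: eq_integral => w _; rewrite /= normrM EFinM.
  rewrite !E; apply: (ge0_le_pullout (W := W)) => //.
  - exact: measurableT_comp.
  - exact: measurableT_comp.
  - by move=> A; exact: cond_exp_contraction.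
  - by apply/measurable_EFinP; exact: measurableT_comp.
split => //; first exact: measurable_funM.
(* For K >= 0, the inequality between weighted integrals applies in both
   directions to H + F and H + U, where H := |F| + |U| makes both nonnegative
   and is subtracted again at the end. *)
have nonneg_case (K : T -> R) :
    measurable_fun (setT : set TW) K -> (forall w, 0 <= K w)%R ->
    P.-integrable setT (EFin \o (fun w => K w * F w)%R) ->
    P.-integrable setT (EFin \o (fun w => K w * U w)%R) ->
    forall A, g_sigma_algebra_preimage W A ->
    \int[P]_(w in A) (K w * U w)%:E = \int[P]_(w in A) (K w * F w)%:E.
  move=> mK K0 iKF iKU A mA; have mA' := sub_measurable mA.
  have mK' := sub_measurable_fun mK.
  pose H w := (`|F w| + `|U w|)%R.
  have mH : measurable_fun setT H.
    by apply: measurable_funD; exact: measurableT_comp.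
  have iH : P.-integrable setT (EFin \o H).
    have iF1 := integrable_norm iF; have iU1 := integrable_norm iU.
    exact: (integrableD measurableT iF1 iU1).
  have iKH : P.-integrable setT (EFin \o (fun w => K w * H w)%R).
    apply: (le_integrable measurableT) (integrableD measurableT
      (integrable_norm iKF) (integrable_norm iKU)).
      exact/measurable_EFinP/measurable_funM.
    suff KHE w : (K w * H w = `|K w * F w| + `|K w * U w|)%R.
      by move=> w _; rewrite /= KHE.
    by rewrite /H mulrDr !normrM (ger0_norm (K0 w)).
  have HG0 G : (forall w, `|G w| <= H w)%R -> forall w, (0 <= H w + G w)%R.
    move=> GH w; rewrite -lerBlDl sub0r.
    by move: (GH w); rewrite ler_norml => /andP[].
  have FH w : (`|F w| <= H w)%R by rewrite /H lerDl.
  have UH w : (`|U w| <= H w)%R by rewrite /H lerDr.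
  have HGint G B : P.-integrable setT (EFin \o G) ->
      g_sigma_algebra_preimage W B ->
      \int[P]_(w in B) (H w + G w)%:E =
      \int[P]_(w in B) (H w)%:E + \int[P]_(w in B) (G w)%:E.
    move=> iG mB; under eq_integral do rewrite EFinD.
    by rewrite integralD_EFin//; [exact: sub_measurable|exact: integrable_sub..].
  have KHGint G : P.-integrable setT (EFin \o (fun w => K w * G w)%R) ->
      \int[P]_w ((\1_A w * K w)%:E * (H w + G w)%:E) =
      \int[P]_(w in A) (K w * H w)%:E + \int[P]_(w in A) (K w * G w)%:E.
    move=> iKG; rewrite -integralD_EFin//; [|exact: integrable_sub..].
    rewrite [RHS]integral_mkcond; apply: eq_integral => w _.
    by rewrite epatch_indic/= -EFinD -!EFinM -mulrA mulrC mulrDr.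
  have mAK : measurable_fun (setT : set TW) (fun w => (\1_A w * K w)%:E).
    by apply/measurable_EFinP/measurable_funM => //; exact: measurable_indic.
  have AK0 w : 0 <= (\1_A w * K w)%:E by rewrite lee_fin mulr_ge0.
  have mHG G : measurable_fun setT G -> measurable_fun setT (fun w => H w + G w)%R.
    exact: measurable_funD.
  have : \int[P]_w ((\1_A w * K w)%:E * (H w + U w)%:E) =
         \int[P]_w ((\1_A w * K w)%:E * (H w + F w)%:E).
    apply/eqP; rewrite eq_le; apply/andP;
      split; apply: (ge0_le_pullout (W := W)) => //;
      solve [exact: mHG|exact: HG0|by move=> B mB; rewrite !HGint// UF].
  rewrite !KHGint// => /eqP; rewrite addeC [X in _ == X]addeC.
  have : \int[P]_(w in A) (K w * H w)%:E \is a fin_num.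
    by apply: integrable_fin_num => //; exact: integrable_sub.
  by move=> fH /eqP/(congr1 (fun x => x - \int[P]_(w in A) (K w * H w)%:E));
    rewrite !addeK.
move=> A mA; have mA' := sub_measurable mA.
(* k is the difference of the nonnegative functions k + |k| and |k| *)
pose kn w := `|k w|%R; pose kp w := (k w + `|k w|)%R.
have mkn : measurable_fun (setT : set TW) kn by exact: measurableT_comp.
have mkp : measurable_fun (setT : set TW) kp by exact: measurable_funD.
have ikn G : P.-integrable setT (EFin \o (fun w => k w * G w)%R) ->
    measurable_fun setT G ->
    P.-integrable setT (EFin \o (fun w => kn w * G w)%R).
  move=> ikG mG; apply: (le_integrable measurableT) ikG.
    by apply/measurable_EFinP/measurable_funM => //; exact: sub_measurable_fun.
  by move=> w _; rewrite /= lee_fin !normrM normr_id.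
have ikp G : P.-integrable setT (EFin \o (fun w => k w * G w)%R) ->
    measurable_fun setT G ->
    P.-integrable setT (EFin \o (fun w => kp w * G w)%R).
  move=> ikG mG; rewrite (_ : _ \o _ =
    (fun w => (k w * G w)%:E + (kn w * G w)%:E)).
    exact: (integrableD measurableT ikG (ikn _ ikG mG)).
  by apply/funext => w; rewrite /= /kp mulrDl.
have kE G : P.-integrable setT (EFin \o (fun w => k w * G w)%R) ->
    measurable_fun setT G -> \int[P]_(w in A) (k w * G w)%:E =
    \int[P]_(w in A) (kp w * G w)%:E - \int[P]_(w in A) (kn w * G w)%:E.
  move=> ikG mG; rewrite -integralB_EFin//.
  - by apply: eq_integral => w _; rewrite -EFinB -mulrBl addrK.
  - by apply: integrable_sub => //; exact: ikp.
  - by apply: integrable_sub => //; exact: ikn.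
rewrite !kE//; congr (_ - _); apply: nonneg_case => //.
- by move=> w; rewrite /kp -lerBlDl sub0r -normrN ler_norm.
- exact: ikp.
- exact: ikp.
- by move=> w; exact: normr_ge0.
- exact: ikn.
- exact: ikn.
Qed.

End conditional_expectation_theory.

(** * Conditional expectations: square integrability and existence *)

Lemma Lfun2P d (T : measurableType d) (R : realType)
    (mu : {measure set T -> \bar R}) (f : T -> R) :
  f \in Lfun mu 2%:E <->
  measurable_fun setT f /\ mu.-integrable setT (fun x => (f x ^+ 2)%:E).
Proof.
split=> [f2|[mf f2]].
  split; last exact: Lfun2_integrable_sqr.
  by move: f2; rewrite inE => /andP[]; rewrite inE.
rewrite inE; apply/andP; split; rewrite inE//=.
rewrite /finite_norm unlock /Lnorm.
apply: poweR_lty; move/integrableP: f2 => [_]; apply: le_lt_trans.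
rewrite le_eqVlt; apply/orP; left; apply/eqP; apply: eq_integral => x _.
by rewrite /= normrX powR_mulrn.
Qed.

Section conditional_expectation_L2.
Context d (T : measurableType d) (R : realType) (P : probability T R).
Context d' (S : measurableType d') (W : T -> S).
Hypothesis mW : measurable_fun setT W.
Local Notation TW := (g_sigma_algebra_preimageType W).
Implicit Types F G U V k : T -> R.

(** If [k] is [U] truncated to [`|U| <= n], then [2 k U - k ^ 2 = k ^ 2] has the
same integral as [2 k F - k ^ 2], which is at most [F ^ 2]; then let [n] go to
infinity. *)
Lemma cond_exp_Lfun2 F U : is_cond_exp P W F U -> F \in Lfun P 2%:E ->
  U \in Lfun P 2%:E.
Proof.
move=> FU /Lfun2P[mF F2]; have [iF iU mU UF] := FU.
have mU' := measurable_fun_sub_sigma_algebra mW mU.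
pose A n := [set w | `|U w| <= n%:R]%R.
have mA n : g_sigma_algebra_preimage W (A n).
  rewrite (_ : A n = (fun w => `|U w|%R) @^-1` `]-oo, n%:R%R]); last first.
    by apply/seteqP; split=> w; rewrite /= in_itv.
  rewrite -[X in g_sigma_algebra_preimage W X]setTI.
  have mnU : measurable_fun (setT : set TW) (fun w => `|U w|%R).
    exact: measurableT_comp.
  exact: mnU.
have mA' n := preimage_sigma_algebra_sub mW (mA n).
have UA n : \int[P]_(w in A n) (U w ^+ 2)%:E <= \int[P]_w (F w ^+ 2)%:E.
  pose k w := (\1_(A n) w * U w)%R.
  have mk : measurable_fun (setT : set TW) k.
    by apply: measurable_funM => //; apply: measurable_indic; exact: mA.
  have mk' := measurable_fun_sub_sigma_algebra mW mk.
  have kn w : (`|k w| <= n%:R)%R.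
    rewrite /k indicE; case: (boolP (w \in A n)).
      by rewrite inE /A/= => Uw; rewrite mul1r.
    by move=> _; rewrite mul0r normr0.
  have bk : [bounded k w | w in [set: T]].
    exists n%:R%R; split => // M nM w _; exact: le_trans (kn w) (ltW nM).
  have ikF : P.-integrable setT (EFin \o (fun w => k w * F w)%R).
    exact: (integrableMr measurableT mk' bk iF).
  have ik : P.-integrable setT (EFin \o k).
    apply: measurable_bounded_integrable => //.
    by rewrite -ge0_fin_numE// fin_num_measure.
  have ikk : P.-integrable setT (EFin \o (fun w => k w * k w)%R).
    exact: (integrableMr measurableT mk' bk ik).
  have kFU := is_cond_expM mW FU mk ikF.
  have kk : is_cond_exp P W (fun w => k w * k w)%R (fun w => k w * k w)%R.
    by apply: is_cond_exp_refl => //; exact: measurable_funM.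
  have [iL _ _ +] := is_cond_expD mW kFU (is_cond_expB mW kFU kk).
  move=> /(_ setT (@measurableT _ TW)) E.
  rewrite integral_mkcond.
  rewrite (eq_integral
    (fun w => (k w * U w + (k w * U w - k w * k w))%:E)); last first.
    move=> w _; rewrite epatch_indic -EFinM /k indicE; congr EFin.
    by case: (w \in A n) => /=;
      rewrite ?(mul1r, mul0r, mulr1, mulr0, subrr, addr0) ?subrr ?addr0.
  rewrite E; apply: le_integral => // w _.
  rewrite lee_fin -subr_ge0.
  have -> : (F w ^+ 2 - (k w * F w + (k w * F w - k w * k w)) = (F w - k w) ^+ 2)%R.
    by rewrite sqrrB expr2 expr2 mulr2n [(F w * k w)%R]mulrC !opprD opprK !addrA.
  exact: sqr_ge0.
apply/Lfun2P; split => //.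
have mU2 : measurable_fun setT (fun w => (U w ^+ 2)%:E).
  by apply/measurable_EFinP; exact: measurable_funX.
apply/integrableP; split => //.
have UAE : \bigcup_n A n = setT.
  apply/seteqP; split => // w _; exists (Num.bound `|U w|) => //.
  by apply: ltW; exact: archi_boundP.
have AU : \int[P]_(w in A n) (U w ^+ 2)%:E @[n --> \oo] -->
    \int[P]_w (U w ^+ 2)%:E.
  rewrite -UAE; apply: ge0_nondecreasing_set_cvg_integral => //.
  - move=> m n mn; apply/subsetPset => w; rewrite /A /= => /le_trans; apply.
    by rewrite ler_nat.
  - by move=> n; exact: measurable_funTS.
  - by move=> n w _; rewrite lee_fin sqr_ge0.
under eq_integral do rewrite gee0_abs ?lee_fin ?sqr_ge0//.
rewrite -(cvg_lim _ AU)//.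
apply: (@le_lt_trans _ _ (\int[P]_w (F w ^+ 2)%:E)).
  by apply: lime_le; [by apply/cvg_ex; eexists; exact: AU|exact: nearW].
move/integrableP: F2 => [_]; apply: le_lt_trans.
rewrite le_eqVlt; apply/orP; left; apply/eqP; apply: eq_integral => x _.
by rewrite gee0_abs ?lee_fin ?sqr_ge0.
Qed.

End conditional_expectation_L2.

Section conditional_expectation_existence.
Context d (T : measurableType d) (R : realType) (P : probability T R).
Context d' (S : measurableType d') (W : {mfun T >-> S}).
Implicit Types F G U V k : T -> R.

(** The image under [W] of the signed measure with density [F] is dominated by
the law of [W]; composing its Radon-Nikodym derivative with [W] gives a version
of the conditional expectation. *)
Lemma is_cond_exp_exists F : P.-integrable setT (EFin \o F) ->
  exists U, is_cond_exp P W F U.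
Proof.
move=> iF; have mW : measurable_fun setT W by [].
pose mu : probability S R := distribution P W.
(* [nu_] is a function of a proof that W is measurable *)
pose nu_ : {charge set S -> \bar R} := pushforward (induced_charge iF) W.
pose nu := nu_ mW.
have numu : nu `<< mu.
  apply/null_content_dominatesP => A mA A0.
  apply: null_set_integral => //; first exact: measurable_funPTI.
  by apply: measurable_funTS; exact: measurable_int iF.
pose f := Radon_Nikodym nu mu.
have iRN : mu.-integrable setT f by exact: Radon_Nikodym_integrable.
have fE s : (fine (f s))%:E = f s by rewrite fineK// Radon_Nikodym_fin_num.
have mf : measurable_fun setT (fun s => fine (f s)).
  apply/measurable_EFinP; rewrite (_ : EFin \o _ = f); first exact: measurable_int iRN.
  by apply/funext => s; rewrite /= fE.
pose U w := fine (f (W w)).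
have UE : EFin \o U = f \o W by apply/funext => w; rewrite /= /U fE.
have iU : P.-integrable setT (EFin \o U).
  apply/integrableP; split.
    exact/measurable_EFinP/(measurableT_comp mf).
  have /integrableP[mRN] := iRN; apply: le_lt_trans.
  rewrite ge0_integral_pushforward//; last exact: measurableT_comp.
  by rewrite preimage_setT UE.
exists U; split => //.
  exact: (measurable_comp_preimage_sigma_algebra (W := W) mf).
move=> A [B mB <-]; rewrite setTI.
rewrite -[RHS]/(nu B) (Radon_Nikodym_integral numu mB).
rewrite integral_pushforward//.
  by rewrite -/f -UE.
by apply: (integrableS measurableT); rewrite -?/f -?UE//; exact: measurable_funPTI.
Qed.

Lemma cond_expP F : P.-integrable setT (EFin \o F) ->
  is_cond_exp P W F (cond_exp P W F).
Proof.
move=> /is_cond_exp_exists[U FU].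
exact: (xgetPex (cst 0%R) (ex_intro _ U FU)).
Qed.

(** An equality of chosen versions everywhere, not merely almost everywhere: the
two functions have the same set of versions. *)
Lemma cond_exp_congr F G : P.-integrable setT (EFin \o F) ->
  P.-integrable setT (EFin \o G) ->
  (forall A, g_sigma_algebra_preimage W A ->
    \int[P]_(w in A) (F w)%:E = \int[P]_(w in A) (G w)%:E) ->
  cond_exp P W F = cond_exp P W G.
Proof.
move=> iF iG FG; rewrite /cond_exp; congr xget.
by apply/seteqP; split => U [_ iU mU UE]; split=> // A mA; rewrite UE// FG.
Qed.

End conditional_expectation_existence.

(** * Conditional covariances *)

Section conditional_covariance.
Context d (T : measurableType d) (R : realType) (P : probability T R).
Context d1 (E : measurableType d1) (Z : {mfun T >-> E}).
Local Notation TZ := (g_sigma_algebra_preimageType Z).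
Implicit Types X Y B : T -> R.

Let Lfun2_integrable X : X \in Lfun P 2%:E -> P.-integrable setT (EFin \o X).
Proof.
move=> X2; apply/Lfun1_integrable; apply: Lfun_subset12 => //.
exact: fin_num_measure.
Qed.

Let Lfun2M X Y : X \in Lfun P 2%:E -> Y \in Lfun P 2%:E ->
  P.-integrable setT (EFin \o (fun w => X w * Y w)%R).
Proof. by move=> X2 Y2; apply/Lfun1_integrable; exact: Lfun2_mul_Lfun1. Qed.

Let Lfun2_cond_exp X : X \in Lfun P 2%:E -> cond_exp P Z X \in Lfun P 2%:E.
Proof.
move=> X2.
by exact: (cond_exp_Lfun2 (W := Z) _ (cond_expP Z (Lfun2_integrable X2)) X2).
Qed.

Let Lfun2B X Y : X \in Lfun P 2%:E -> Y \in Lfun P 2%:E ->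
  (fun w => X w - Y w)%R \in Lfun P 2%:E.
Proof.
move=> X2 Y2; rewrite -[X in X \in _]/((X : T -> R) - Y)%R.
by rewrite rpredB ?lee1n.
Qed.

(** [X - E[X | Z]] is measurable for [W], so multiplied by [B - E[Y | Z]] it is a
version of the conditional expectation given [W] of its product with
[Y - E[Y | Z]]; the two products therefore have the same integrals on the events
of the coarser sigma-algebra. *)
Lemma cond_cov_tower d2 (S : measurableType d2) (W : {mfun T >-> S}) X Y B :
  g_sigma_algebra_preimage Z `<=` g_sigma_algebra_preimage W ->
  measurable_fun (setT : set (g_sigma_algebra_preimageType W)) X ->
  X \in Lfun P 2%:E -> Y \in Lfun P 2%:E -> is_cond_exp P W Y B ->
  cond_cov P Z X B = cond_cov P Z X Y.
Proof.
move=> ZW mX X2 Y2 YB; have [iY iB mB BY] := YB.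
have B2 : B \in Lfun P 2%:E by exact: cond_exp_Lfun2 YB Y2.
have BYZ : cond_exp P Z B = cond_exp P Z Y.
  by apply: cond_exp_congr => // A /ZW; exact: BY.
rewrite /cond_cov BYZ.
have [_ iX' mX' _] := cond_expP Z (Lfun2_integrable X2).
have [_ iY' mY' _] := cond_expP Z iY.
set X' := cond_exp P Z X in mX' iX' *; set Y' := cond_exp P Z Y in mY' iY' *.
have YBc : is_cond_exp P W (fun w => Y w - Y' w)%R (fun w => B w - Y' w)%R.
  apply: is_cond_expB => //; apply: is_cond_exp_refl => //.
  exact: measurable_fun_sigma_algebra_mono mY'.
have [|||i1 i2 _ HE] := is_cond_expM _ YBc (k := fun w => (X w - X' w)%R).
- by [].
- by apply: measurable_funB => //; exact: measurable_fun_sigma_algebra_mono mX'.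
- by apply: Lfun2M; apply: Lfun2B => //; exact: Lfun2_cond_exp.
by apply: cond_exp_congr => // A /ZW; exact: HE.
Qed.

(** [B - E[B | Z] = beta * (X - E[X | Z])] almost everywhere, and [beta] can be
pulled out of the conditional variance. *)
Lemma cond_cov_affine X B (beta Gamma : T -> R) :
  X \in Lfun P 2%:E -> B \in Lfun P 2%:E ->
  measurable_fun (setT : set TZ) beta -> measurable_fun (setT : set TZ) Gamma ->
  (forall w, B w = beta w * X w + Gamma w)%R ->
  P.-integrable setT (EFin \o (fun w => beta w * cond_var P Z X w)%R) /\
  \int[P]_w (cond_cov P Z X B w)%:E = \int[P]_w (beta w * cond_var P Z X w)%:E.
Proof.
move=> X2 B2 mb mG BE.
have iX := Lfun2_integrable X2; have iB := Lfun2_integrable B2.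
have XX' := cond_expP Z iX; have BB' := cond_expP Z iB.
have X'2 := Lfun2_cond_exp X2; have B'2 := Lfun2_cond_exp B2.
rewrite /cond_cov /cond_var.
set X' := cond_exp P Z X in XX' X'2 *; set B' := cond_exp P Z B in BB' B'2 *.
have B'E : {ae P, forall w, B' w = beta w * X' w + Gamma w}%R.
  (* beta * X and Gamma need not be integrable; the weight k > 0 makes k * beta
     and k * Gamma bounded, and is cancelled once the versions are compared. *)
  pose c w := expR (`|beta w| + `|Gamma w|).
  have c1 w (x : R) : (x <= `|beta w| + `|Gamma w|)%R -> (x <= c w)%R.
    move=> xbG; apply: le_trans xbG _; apply: le_trans (expR_ge1Dx _).
    by rewrite lerDr.
  pose k w := expR (- (`|beta w| + `|Gamma w|)).
  have kc w : (k w * c w = 1)%R by rewrite /k /c -expRD addNr expR0.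
  have mk : measurable_fun (setT : set TZ) k.
    apply: measurableT_comp => //; apply: measurableT_comp => //.
    by apply: measurable_funD; exact: measurableT_comp.
  have le1 (f : T -> R) : measurable_fun (setT : set TZ) f ->
      (forall w, `|f w| <= c w)%R -> forall G, P.-integrable setT (EFin \o G) ->
      P.-integrable setT (EFin \o (fun w => k w * f w * G w)%R).
    move=> mf fc G iG.
    apply: (@integrableMr _ _ _ P _ _ (fun w => k w * f w)%R (EFin \o G)) => //.
      by apply: (measurable_fun_sub_sigma_algebra (W := Z)) => //; exact: measurable_funM.
    exists 1%R; split => // M M1 w _; apply: le_trans (ltW M1).
    by rewrite normrM (gtr0_norm (expR_gt0 _)) -(kc w) ler_wpM2l// ltW// expR_gt0.
  have kb G : P.-integrable setT (EFin \o G) ->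
      P.-integrable setT (EFin \o (fun w => k w * beta w * G w)%R).
    by apply: le1 => // w; apply: c1; rewrite lerDl.
  have i1 : P.-integrable setT (EFin \o cst 1%R).
    exact: finite_measure_integrable_cst.
  have ikG : P.-integrable setT (EFin \o (fun w => k w * Gamma w)%R).
    rewrite (_ : _ \o _ = EFin \o (fun w => k w * Gamma w * cst 1 w)%R); last first.
      by apply/funext => w; rewrite /= mulr1.
    by apply: le1 => // w; apply: c1; rewrite lerDr.
  have ikB : P.-integrable setT (EFin \o (fun w => k w * B w)%R).
    rewrite (_ : _ \o _ = EFin \o (fun w => k w * cst 1 w * B w)%R); last first.
      by apply/funext => w; rewrite /= mulr1.
    apply: le1 => // w; rewrite /c normr1 (le_trans _ (expR_ge1Dx _))//.
    by rewrite lerDl addr_ge0.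
  have mkb : measurable_fun (setT : set TZ) (fun w => k w * beta w)%R.
    exact: measurable_funM.
  have mkG : measurable_fun (setT : set TZ) (fun w => k w * Gamma w)%R.
    exact: measurable_funM.
  have kBB' := is_cond_expM _ BB' mk ikB.
  have := is_cond_expD _ (is_cond_expM _ XX' mkb (kb _ iX))
    (is_cond_exp_refl ikG mkG).
  rewrite (_ : (fun w => _ + _)%R = (fun w => k w * B w)%R); last first.
    by apply/funext => w; rewrite BE mulrDr mulrA.
  move=> kBX'; apply: filterS (cond_exp_unique _ (kBB' _) (kBX' _ _)) => //= w.
  rewrite -mulrA -mulrDr; apply: mulfI; exact: lt0r_neq0 (expR_gt0 _).
have iXB : P.-integrable setT (EFin \o (fun w => (X w - X' w) * (B w - B' w))%R).
  by apply: Lfun2M; exact: Lfun2B.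
have iXX : P.-integrable setT (EFin \o (fun w => (X w - X' w) ^+ 2)%R).
  by apply: Lfun2M; exact: Lfun2B.
have [_ _ _ XBE] := cond_expP Z iXB.
have bE : {ae P, forall w, ((X w - X' w) * (B w - B' w) =
    beta w * (X w - X' w) ^+ 2)%R}.
  by apply: filterS B'E => w ->; rewrite BE; ring.
have mbXX : measurable_fun setT (EFin \o (fun w => beta w * (X w - X' w) ^+ 2)%R).
  apply/measurable_EFinP/measurable_funM.
    exact: measurable_fun_sub_sigma_algebra mb.
  exact/measurable_EFinP/(measurable_int _ iXX).
have ibXX : P.-integrable setT (EFin \o (fun w => beta w * (X w - X' w) ^+ 2)%R).
  have /integrableP[_] := iXB; move=> iXBoo; apply/integrableP; split => //.
  rewrite (_ : integral _ _ _ = \int[P]_w `|((X w - X' w) * (B w - B' w))%:E|)//.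
  apply: ae_eq_integral => //.
  - exact: measurableT_comp.
  - by apply: measurableT_comp => //; exact: measurable_int iXB.
  - by apply: filterS bE => w wE _ /=; rewrite wE.
have [//|_ ibV _ bVE] := is_cond_expM _ (cond_expP Z iXX) mb ibXX.
have sT : g_sigma_algebra_preimage Z setT by exact: (@measurableT _ TZ).
split => //; rewrite (XBE _ sT) (bVE _ sT).
apply: ae_eq_integral => //; first exact: measurable_int iXB.
by apply: filterS bE => w ? _ /=; congr EFin.
Qed.

End conditional_covariance.

(** * Mixtures of measures and disintegration *)

Section mixture.
Context d1 d2 (X : measurableType d1) (Y : measurableType d2) (R : realType).
Variables (nu : {measure set X -> \bar R}) (k : X -> {measure set Y -> \bar R}).
Hypothesis mk : forall A, measurable A -> measurable_fun setT (k ^~ A).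

Definition mixture (A : set Y) : \bar R := \int[nu]_x k x A.

Let mixture0 : mixture set0 = 0.
Proof. by rewrite /mixture integral0_eq. Qed.

Let mixture_ge0 A : 0 <= mixture A. Proof. exact: integral_ge0. Qed.

Let mixture_sigma_additive : semi_sigma_additive mixture.
Proof.
move=> U mU tU mUU; rewrite [X in _ --> X](_ : _ =
  \int[nu]_x (\sum_(n <oo) k x (U n))); last first.
  apply: eq_integral => x _.
  by apply/esym/cvg_lim => //; exact/measure_semi_sigma_additive.
rewrite integral_nneseries//; last by move=> n; exact: mk.
by apply: is_cvg_nneseries => n _ _; exact: integral_ge0.
Qed.

HB.instance Definition _ := isMeasure.Build _ _ _ mixture
  mixture0 mixture_ge0 mixture_sigma_additive.

(** [mu] is kept apart from [mixture] so that the lemma applies to any measure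
known to have these values. *)
Lemma integral_mixture (mu : {measure set Y -> \bar R}) (f : Y -> \bar R) :
  (forall A, measurable A -> mu A = mixture A) ->
  measurable_fun setT f -> (forall y, 0 <= f y) ->
  \int[mu]_y f y = \int[nu]_x \int[k x]_y f y.
Proof.
move=> muE.
pose Q (h : Y -> \bar R) := \int[mu]_y h y = \int[nu]_x \int[k x]_y h y.
have mint h : measurable_fun setT h -> (forall y, 0 <= h y) ->
    measurable_fun setT (fun x => \int[k x]_y h y).
  by move=> mh h0; exact: measurable_fun_integral_kernel.
move=> mf f0; apply: (@ge0_measurable_ind _ _ R Q) mf f0; rewrite /Q.
- move=> A mA; rewrite integral_indic// setIT muE//.
  by apply: eq_integral => x _; rewrite integral_indic// setIT.
- move=> c h c0 mh h0 IH.
  transitivity (\int[nu]_x (c%:E * \int[k x]_y h y)).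
    rewrite [LHS]ge0_integralZl_EFin// IH; apply/esym/ge0_integralZl_EFin => //;
      by [exact: mint|move=> x _; exact: integral_ge0].
  by apply: eq_integral => x _; rewrite ge0_integralZl_EFin.
- move=> h g mh h0 IHh mg g0 IHg.
  transitivity (\int[nu]_x (\int[k x]_y h y + \int[k x]_y g y)).
    rewrite [LHS]ge0_integralD// IHh IHg; apply/esym/ge0_integralD => //;
      by [exact: mint|move=> x _; exact: integral_ge0].
  by apply: eq_integral => x _; rewrite ge0_integralD.
- move=> h mh h0 ndh IH; rewrite monotone_convergence//.
  under eq_fun do rewrite IH.
  rewrite -monotone_convergence//.
  + by apply: eq_integral => x _;
      rewrite -monotone_convergence// => y _ m n; exact: ndh.
  + by move=> n; exact: mint.
  + by move=> n x _; exact: integral_ge0.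
  + move=> x _ m n mn; apply: ge0_le_integral => // y _; exact: ndh.
Qed.

End mixture.

Section disintegration.
Context d (T : measurableType d) (R : realType) (P : probability T R).
Context d1 (S1 : measurableType d1) d2 (S2 : measurableType d2).
Variables (V : {mfun T >-> S1}) (W : {mfun T >-> S2}) (k : R.-fker S1 ~> S2).

(** Both sides are integrals of [h] on [S1 * S2]: against the law of [(V, W)] and
against the mixture over [P] of the images of [k (V w)] in the section at
[V w]. These two measures agree on a generating class closed under
intersection. *)
Lemma disintegration (G : set (set (S1 * S2))) :
  (measurable : set (set (S1 * S2))) = <<s G >> -> setI_closed G -> G setT ->
  (forall H, G H -> P ((fun w => (V w, W w)) @^-1` H) =
    \int[P]_w k (V w) (xsection H (V w))) ->
  forall h : S1 * S2 -> \bar R,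
  measurable_fun setT h -> (forall vu, 0 <= h vu) ->
  \int[P]_w h (V w, W w) = \int[P]_w \int[k (V w)]_u h (V w, u).
Proof.
move=> GE GI GT PG h mh h0.
have mVW : measurable_fun setT (fun w => (V w, W w)) by exact: measurable_fun_pair.
have mpair w : measurable_fun setT (fun u : S2 => (V w, u)).
  exact: measurable_fun_pair.
pose kk_ w : {measure set (S1 * S2) -> \bar R} :=
  pushforward (k (V w)) (fun u => (V w, u)).
pose kk := kk_ mpair.
have kkE w A : kk w A = k (V w) (xsection A (V w)).
  by rewrite xsectionE.
have mkk A : measurable A -> measurable_fun setT (kk ^~ A).
  move=> mA; under eq_fun do rewrite kkE.
  have := measurable_fun_xsection_finite_kernel k (mem_set mA).
  by move=> /measurableT_comp; apply.
pose m1_ : {measure set (S1 * S2) -> \bar R} :=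
  pushforward P (fun w => (V w, W w)).
pose m1 := m1_ mVW.
have m1E A : measurable A -> m1 A = mixture P kk A.
  move=> mA.
  apply: (@measure_unique _ _ _ G (fun=> setT) _ _ _ _ m1 (mixture P kk)) => //.
  - by rewrite bigcup_const.
  - move=> B GB; rewrite [LHS]PG//; apply: eq_integral => w _.
    by rewrite kkE.
  - by move=> _; rewrite /m1 /m1_/= /pushforward preimage_setT probability_setT ltry.
transitivity (\int[m1]_vu h vu); first by rewrite ge0_integral_pushforward.
rewrite (integral_mixture mkk m1E)//; apply: eq_integral => w _.
by rewrite ge0_integral_pushforward.
Qed.

End disintegration.

(** * Consequences of conditional independence *)

Definition cylinder (R : realType) (N : nat) (B : nat -> set R) :
    set (realseq R) :=
  [set u | forall n, (n < N)%N -> B n (u n)].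

Lemma measurable_cylinder (R : realType) N (B : nat -> set R) :
  (forall n, measurable (B n)) -> measurable (cylinder N B).
Proof.
move=> mB; rewrite (_ : cylinder N B =
    \bigcap_n [set u : realseq R | (n < N)%N -> B n (u n)]); last first.
  by apply/seteqP; split => [u uB n _ /=|u uB n nN]; [exact: uB|exact: uB].
apply: bigcapT_measurable => n; case: (ltnP n N) => nN.
  rewrite (_ : [set _ | _] = (fun u : nat -> R => u n) @^-1` (B n)).
    by apply: sub_sigma_algebra; exists n, (B n).
  by apply/seteqP; split => [u /= /(_ isT)|u /=].
by rewrite (_ : [set _ | _] = setT)//; apply/seteqP; split.
Qed.

Section boxes.
Context (R : realType) d (E : measurableType d).

Definition boxes : set (set ((R * E) * realseq R)) :=
  [set H | exists C D N (B : nat -> set R),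
    [/\ measurable C, measurable D, forall n, measurable (B n) &
        H = (C `*` D) `*` cylinder N B]].

Lemma boxesT : boxes setT.
Proof.
exists setT, setT, 0%N, (fun=> setT); split => //.
by apply/seteqP; split.
Qed.

Lemma boxes_setI : setI_closed boxes.
Proof.
move=> _ _ [C [D [N [B [mC mD mB ->]]]]] [C' [D' [N' [B' [mC' mD' mB' ->]]]]].
exists (C `&` C'), (D `&` D'), (maxn N N'), (fun n =>
  (if (n < N)%N then B n else setT) `&` (if (n < N')%N then B' n else setT)).
split; [exact: measurableI|exact: measurableI| |].
  by move=> n; apply: measurableI; case: ifP.
rewrite -!setXI; congr (_ `*` _); apply/seteqP; split => u /=.
  by move=> [uB uB'] n _; split; case: ifPn => // ?; [exact: uB|exact: uB'].
move=> uBB; split => n nN.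
  by have [] := uBB n; rewrite ?leq_max ?nN.
by have [] := uBB n; rewrite ?leq_max ?nN ?orbT.
Qed.

(** The identity is measurable from the sigma-algebra generated by the boxes to
the product sigma-algebra because each of its coordinates is. *)
Lemma boxes_generate :
  (measurable : set (set ((R * E) * realseq R))) = <<s boxes >>.
Proof.
apply/seteqP; split; last first.
  apply: smallest_sub; first exact: sigma_algebra_measurable.
  move=> _ [C [D [N [B [mC mD mB ->]]]]].
  by apply: measurableX; [exact: measurableX|exact: measurable_cylinder].
pose G := g_sigma_algebraType boxes.
have mbox C D N (B : nat -> set R) : measurable C -> measurable D ->
    (forall n, measurable (B n)) ->
    measurable ((C `*` D) `*` cylinder N B : set G).
  by move=> mC mD mB; apply: sub_sigma_algebra; exists C, D, N, B.
have cyl0 (B : nat -> set R) : cylinder 0 B = setT.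
  by apply/seteqP; split.
have m11 : measurable_fun setT (fun x : G => x.1.1).
  move=> _ B mB; rewrite (_ : _ `&` _ = (B `*` setT) `*` cylinder 0 (fun=> setT)).
    exact: mbox.
  by rewrite cyl0; apply/seteqP; split => [[[? ?] ?] []|[[? ?] ?] [[]]].
have m12 : measurable_fun setT (fun x : G => x.1.2).
  move=> _ B mB; rewrite (_ : _ `&` _ = (setT `*` B) `*` cylinder 0 (fun=> setT)).
    exact: mbox.
  by rewrite cyl0; apply/seteqP; split => [[[? ?] ?] []|[[? ?] ?] [[]]].
have m2 : measurable_fun setT (fun x : G => x.2).
  apply: (@measurability _ _ G (realseq R) setT _ (coordinate_sets R)) => //.
  move=> _ [_ [n [B [mB ->]]] <-].
  rewrite (_ : _ `&` _ = (setT `*` setT) `*`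
      cylinder n.+1 (fun m => if m == n then B else setT)).
    by apply: mbox => // m; case: ifP.
  apply/seteqP; split => [[[? ?] u] [_ /= Bu]|[[? ?] u] [_ /= Bu]]; split => //=.
    by move=> m _; case: eqP => // ->.
  by have := Bu n (ltnSn n); rewrite eqxx.
move=> A mA; have mid : measurable_fun setT (fun x : G => ((x.1.1, x.1.2), x.2)).
  by apply: measurable_fun_pair => //; exact: measurable_fun_pair.
have := mid measurableT A mA; rewrite setTI.
by rewrite (_ : _ @^-1` A = A)//; apply/seteqP; split => [[[? ?] ?]|[[? ?] ?]].
Qed.

End boxes.

Section conditional_independence.
Context d (T : measurableType d) (R : realType) (P : probability T R).
Context d1 (E : measurableType d1) (Z : {mfun T >-> E}).
Variables (X : nat -> {mfun T >-> R}) (i : nat).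

(** Conditional independence is used twice, for the coordinates of the cylinder
with and without [X i]; the common product of conditional probabilities is that
of the cylinder. *)
Lemma cond_prob_boxes (C : set R) N (B : nat -> set R) :
  cond_independent P Z X -> measurable C -> (forall n, measurable (B n)) ->
  {ae P, forall w,
    cond_prob P Z (X i @^-1` C `&` drop_coord X i @^-1` cylinder N B) w =
    (cond_prob P Z (X i @^-1` C) w *
     cond_prob P Z (drop_coord X i @^-1` cylinder N B) w)%R}.
Proof.
move=> indep mC mB.
pose J0 := [fset j in map (bump i) (iota 0 N)]%fset.
pose B' j := if j == i then C else B (unbump i j).
have mB' j : measurable (B' j) by rewrite /B'; case: ifP.
have iJ0 : i \notin J0.
  rewrite !inE; apply/mapP => -[n _ /eqP]; apply/negP; exact: neq_bump.
have J0E : \bigcap_(j in [set` J0]) (X j @^-1` B' j) =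
    drop_coord X i @^-1` cylinder N B.
  apply/seteqP; split => w /= wB.
    move=> n nN; have := wB (bump i n); rewrite /= !inE map_f ?mem_iota//.
    by move=> /(_ isT); rewrite /B' eq_sym (negbTE (neq_bump i n)) bumpK.
  move=> j; rewrite /= !inE => /mapP[n]; rewrite mem_iota add0n => /andP[_ nN] ->.
  by rewrite /B' eq_sym (negbTE (neq_bump i n)) bumpK; exact: wB.
have JE : \bigcap_(j in [set` (i |` J0)%fset]) (X j @^-1` B' j) =
    X i @^-1` C `&` drop_coord X i @^-1` cylinder N B.
  rewrite set_fsetU1 bigcap_setU1 J0E; congr (_ `&` _).
  by rewrite /B' eqxx.
have := indep (i |` J0)%fset B' mB'; have := indep J0 B' mB'.
rewrite JE J0E; apply: filterS2 => w -> ->.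
by rewrite big_fsetU1//= {1}/B' eqxx.
Qed.

(** The conditional probability [g] of the cylinder given [Z] may be computed as
if [X i] were known too. *)
Lemma cond_independent_boxes (C : set R) (D : set E) N (B : nat -> set R)
    (g : T -> R) :
  cond_independent P Z X -> measurable C -> measurable D ->
  (forall n, measurable (B n)) ->
  is_cond_exp P Z (\1_(drop_coord X i @^-1` cylinder N B)) g ->
  (forall w, 0 <= g w <= 1)%R ->
  P (X i @^-1` C `&` Z @^-1` D `&` drop_coord X i @^-1` cylinder N B) =
  \int[P]_(w in X i @^-1` C `&` Z @^-1` D) (g w)%:E.
Proof.
move=> indep mC mD mB gE g01; have mZ : measurable_fun setT Z by [].
set V := drop_coord X i @^-1` cylinder N B.
set A := X i @^-1` C.
have mA : measurable A by exact: measurable_funPTI.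
have mV : measurable V.
  by apply: measurable_funPTI; exact: measurable_cylinder.
have mZD : measurable (Z @^-1` D) by exact: measurable_funPTI.
have sZD : g_sigma_algebra_preimage Z (Z @^-1` D) by exists D; rewrite ?setTI.
have indP H : measurable H -> is_cond_exp P Z (\1_H) (cond_prob P Z H).
  by move=> mH; apply: cond_expP; exact: integrable_indic.
have [_ _ mg _] := gE.
have igA : P.-integrable setT (EFin \o (fun w => g w * \1_A w)%R).
  apply: (@integrableMr _ _ _ P _ _ g (EFin \o \1_A)) => //.
  - exact: measurable_fun_sub_sigma_algebra mg.
  - exists 1%R; split => // M M1 w _; have /andP[g0 g1] := g01 w.
    by rewrite /= ger0_norm// (le_trans g1)// ltW.
  - exact: integrable_indic.
have gA := is_cond_expM mZ (indP _ mA) mg igA.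
have [_ _ _ AVE] := indP _ (measurableI _ _ mA mV).
have [_ icg _ gAE] := gA.
transitivity (\int[P]_(w in Z @^-1` D) (cond_prob P Z (A `&` V) w)%:E).
  rewrite AVE// integral_indic//; last exact: measurableI.
  by congr (P _); rewrite setIAC.
transitivity (\int[P]_(w in Z @^-1` D) (g w * cond_prob P Z A w)%:E).
  apply: ae_eq_integral => //.
  - apply: measurable_funTS.
    by case: (indP _ (measurableI _ _ mA mV)) => _ /measurable_int.
  - by apply: measurable_funTS; exact: measurable_int icg.
  have := cond_exp_unique mZ gE (indP _ mV).
  have := cond_prob_boxes N indep mC mB.
  by apply: filterS2 => w -> -> _; rewrite mulrC.
rewrite gAE// setIC [RHS]integral_mkcondr; apply: eq_integral => w _.
by rewrite epatch_indic EFinM.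
Qed.

End conditional_independence.

(** * The regression function as a conditional expectation *)

Lemma pker_le1 d1 (S1 : measurableType d1) d2 (S2 : measurableType d2)
    (R : realType) (k : R.-pker S1 ~> S2) v B : measurable B -> k v B <= 1.
Proof.
move=> mB; apply: le_trans (sprob_kernel_le1 k v).
by apply: le_measure; rewrite ?inE.
Qed.

Lemma pker_fin_num d1 (S1 : measurableType d1) d2 (S2 : measurableType d2)
    (R : realType) (k : R.-pker S1 ~> S2) v B :
  measurable B -> k v B \is a fin_num.
Proof.
move=> mB; rewrite ge0_fin_numE//.
by apply: le_lt_trans (pker_le1 k v mB) _; rewrite ltry.
Qed.

(** The defining property of a regular conditional distribution is the case where
[h] is the indicator function of a measurable rectangle. *)
Lemma reg_cond_dist_integral d (T : measurableType d) (R : realType)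
    (P : probability T R) d1 (S1 : measurableType d1) d2 (S2 : measurableType d2)
    (V : {mfun T >-> S1}) (W : {mfun T >-> S2}) (k : R.-pker S1 ~> S2)
    (h : S1 * S2 -> \bar R) :
  is_reg_cond_dist P V W k ->
  measurable_fun setT h -> (forall vu, 0 <= h vu) ->
  \int[P]_w h (V w, W w) = \int[P]_w \int[k (V w)]_u h (V w, u).
Proof.
move=> rcd; apply: disintegration.
- exact: measurable_prod_measurableType.
- move=> _ _ [A mA [B mB <-]] [A' mA' [B' mB' <-]].
  exists (A `&` A'); first exact: measurableI.
  by exists (B `&` B'); [exact: measurableI|rewrite setXI].
- by exists setT => //; exists setT => //; rewrite setXTT.
move=> _ [A mA [B mB <-]].
have mVA : measurable (V @^-1` A) by exact: measurable_funPTI.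
have mWB : measurable (W @^-1` B) by exact: measurable_funPTI.
have [_ _ _ /(_ (V @^-1` A))] := rcd B mB.
rewrite integral_indic// => E.
transitivity (P (W @^-1` B `&` V @^-1` A)).
  by congr (P _); apply/seteqP; split => w [].
rewrite -E; last by exists A; rewrite ?setTI.
rewrite [LHS]integral_mkcond; apply: eq_integral => w _.
rewrite epatch_indic /= indicE fineK; last exact: pker_fin_num.
have [wA|wA] := boolP (w \in V @^-1` A).
  by rewrite mule1 in_xsectionX//; rewrite inE in wA *.
by rewrite mule0 notin_xsectionX ?measure0.
Qed.

Section regression.
Context d (T : measurableType d) (R : realType) (P : probability T R).
Context d1 (E : measurableType d1) (Z : {mfun T >-> E}).
Variables (Y : {mfun T >-> R}) (X : nat -> {mfun T >-> R}) (i : nat).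
Variables (Pi : R.-pker (R * realseq R)%type ~> R) (Pmi : R.-pker E ~> realseq R).
Hypothesis Pi_rcd : is_reg_cond_dist P (split_coord X i) Y Pi.
Hypothesis Pmi_rcd : is_reg_cond_dist P Z (drop_coord X i) Pmi.
Hypothesis indep : cond_independent P Z X.
Hypothesis Zsub :
  g_sigma_algebra_preimage Z `<=` g_sigma_algebra_preimage (drop_coord X i).

Definition cond_pair (w : T) : R * E := (X i w, Z w).

Let measurable_cond_pair : measurable_fun setT cond_pair.
Proof. exact: measurable_fun_pair. Qed.

HB.instance Definition _ :=
  isMeasurableFun.Build _ _ _ _ cond_pair measurable_cond_pair.

Let measurable_split_coord : measurable_fun setT (split_coord X i).
Proof. exact: measurable_fun_pair. Qed.

HB.instance Definition _ :=
  isMeasurableFun.Build _ _ _ _ (split_coord X i) measurable_split_coord.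

(** Given [(X_i, Z)], the other coordinates are distributed according to
[Pmi Z]: knowing [X_i] as well does not change their law given [Z]. *)
Lemma joint_integral (h : (R * E) * realseq R -> \bar R) :
  measurable_fun setT h -> (forall v, 0 <= h v) ->
  \int[P]_w h (X i w, Z w, drop_coord X i w) =
  \int[P]_w \int[Pmi (Z w)]_u h (X i w, Z w, u).
Proof.
pose k : R.-spker (R * E)%type ~> realseq R := kernel.kernel_snd Pmi.
apply: (@disintegration _ _ _ P _ _ _ _ cond_pair (drop_coord X i) k _
  (@boxes_generate R _ E) (@boxes_setI R _ E) (@boxesT R _ E)).
move=> _ [C [D [N [B [mC mD mB ->]]]]].
have mcyl := measurable_cylinder N mB.
have mXC : measurable (X i @^-1` C) by exact: measurable_funPTI.
have mZD : measurable (Z @^-1` D) by exact: measurable_funPTI.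
transitivity
    (P (X i @^-1` C `&` Z @^-1` D `&` drop_coord X i @^-1` cylinder N B)).
  by congr (P _); apply/seteqP; split => w [[]].
rewrite (cond_independent_boxes indep mC mD mB (Pmi_rcd mcyl)); last first.
  move=> w; rewrite fine_ge0//= -lee_fin fineK ?pker_fin_num//.
  exact: pker_le1.
rewrite [LHS]integral_mkcond; apply: eq_integral => w _.
rewrite epatch_indic /= indicE fineK; last exact: pker_fin_num.
have [wCD|wCD] := boolP (w \in _).
  by rewrite mule1 in_xsectionX//; move: wCD; rewrite !inE.
by rewrite mule0 notin_xsectionX ?measure0.
Qed.

Lemma split_coord_finer A : g_sigma_algebra_preimage cond_pair A ->
  g_sigma_algebra_preimage (split_coord X i) A.
Proof.
pose TS := g_sigma_algebra_preimageType (split_coord X i).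
have mX : measurable_fun (setT : set TS) (X i).
  exact: (@measurable_comp_preimage_sigma_algebra _ T _ _ (split_coord X i) _ R fst).
have mZ : measurable_fun (setT : set TS) Z.
  move=> _ B mB; rewrite setTI.
  have sB : g_sigma_algebra_preimage Z (Z @^-1` B) by exists B; rewrite ?setTI.
  have [B' mB' <-] := Zsub sB.
  exists (snd @^-1` B'); last by [].
  by rewrite -[X in measurable X]setTI; exact: measurable_snd.
have mc : measurable_fun (setT : set TS) cond_pair.
  exact: measurable_fun_pair.
by move=> [D mD <-]; exact: mc.
Qed.

Lemma mixed_kernel_integral (g : R -> \bar R) x z :
  measurable_fun setT g -> (forall y, 0 <= g y) ->
  \int[mixed_kernel Pi Pmi x z]_y g y =
  \int[Pmi z]_u \int[Pi (x, u)]_y g y.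
Proof.
move=> mg g0.
apply: (integral_mixture (k := fun u => Pi (x, u))) => // U mU.
by apply: (measurableT_comp (measurable_kernel Pi U mU)); exact: pair1_measurable.
Qed.

Lemma measurable_mixed_kernel_integral (g : R -> \bar R) :
  measurable_fun setT g -> (forall y, 0 <= g y) ->
  measurable_fun setT
    (fun xz : R * E => \int[mixed_kernel Pi Pmi xz.1 xz.2]_y g y).
Proof.
move=> mg g0; under eq_fun do rewrite mixed_kernel_integral//.
pose k : R.-spker (R * E)%type ~> realseq R := kernel.kernel_snd Pmi.
pose h (vu : (R * E) * realseq R) := \int[Pi (vu.1.1, vu.2)]_y g y.
have mG : measurable_fun setT (fun s => \int[Pi s]_y g y).
  by apply: measurable_fun_integral_kernel => // U mU; exact: measurable_kernel.
apply: (measurable_fun_integral_finite_kernel h k).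
  by move=> vu; exact: integral_ge0.
apply: (measurableT_comp mG); apply: measurable_fun_pair => //.
exact: (measurableT_comp measurable_fst measurable_fst).
Qed.

(** [Q^i_{X_i, Z}] is a conditional distribution of [Y] given [(X_i, Z)]: the
event [A] is also an event about all the coordinates, so that the kernel [Pi]
may first replace [Y], and then [Pmi Z] replaces the coordinates other than
[X_i]. *)
Lemma response_integral (g : R -> \bar R) A :
  measurable_fun setT g -> (forall y, 0 <= g y) ->
  g_sigma_algebra_preimage cond_pair A ->
  \int[P]_(w in A) g (Y w) =
  \int[P]_(w in A) \int[mixed_kernel Pi Pmi (X i w) (Z w)]_y g y.
Proof.
move=> mg g0 sA.
have [D mD] := sA; rewrite setTI => DA.
have [D' mD'] := split_coord_finer sA; rewrite setTI => D'A.
pose G (s : R * realseq R) := \int[Pi s]_y g y.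
have G0 s : 0 <= G s by exact: integral_ge0.
have mG : measurable_fun setT G.
  by apply: measurable_fun_integral_kernel => // U mU; exact: measurable_kernel.
transitivity (\int[P]_(w in A) G (split_coord X i w)).
  rewrite 2!(integral_mkcond A) -D'A.
  pose h (sy : (R * realseq R) * R) := g sy.2 * (\1_D' sy.1)%:E.
  transitivity (\int[P]_w h (split_coord X i w, Y w)).
    by apply: eq_integral => w _; rewrite epatch_indic.
  rewrite (reg_cond_dist_integral Pi_rcd); last 2 first.
  - apply: emeasurable_funM; first exact: measurableT_comp.
    apply/measurable_EFinP.
    have mD'1 : measurable_fun setT (\1_D' : R * realseq R -> R).
      exact: measurable_indic.
    exact: (measurableT_comp mD'1 measurable_fst).
  - by move=> sy; rewrite mule_ge0// lee_fin.
  apply: eq_integral => w _; rewrite epatch_indic /h/=.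
  by rewrite ge0_integralZr.
transitivity (\int[P]_(w in A) \int[Pmi (Z w)]_u G (X i w, u)).
  rewrite 2!(integral_mkcond A) -DA.
  pose h (vu : (R * E) * realseq R) := G (vu.1.1, vu.2) * (\1_D vu.1)%:E.
  transitivity (\int[P]_w h (X i w, Z w, drop_coord X i w)).
    by apply: eq_integral => w _; rewrite epatch_indic.
  rewrite joint_integral; last 2 first.
  - apply: emeasurable_funM.
      apply: (measurableT_comp mG); apply: measurable_fun_pair => //.
      exact: (measurableT_comp measurable_fst measurable_fst).
    apply/measurable_EFinP.
    have mD1 : measurable_fun setT (\1_D : R * E -> R) by exact: measurable_indic.
    exact: (measurableT_comp mD1 measurable_fst).
  - by move=> vu; rewrite mule_ge0// lee_fin.
  apply: eq_integral => w _; rewrite epatch_indic /h/=.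
  rewrite ge0_integralZr//.
  by apply: (measurableT_comp mG); exact: pair1_measurable.
by apply: eq_integral => w _; rewrite mixed_kernel_integral.
Qed.

Lemma measurable_regression :
  measurable_fun setT (fun xz : R * E => regression Pi Pmi xz.1 xz.2).
Proof.
have -> : (fun xz : R * E => regression Pi Pmi xz.1 xz.2) = fun xz =>
    fine (\int[mixed_kernel Pi Pmi xz.1 xz.2]_y (EFin^\+ y) -
          \int[mixed_kernel Pi Pmi xz.1 xz.2]_y (EFin^\- y)).
  by apply/funext => xz; rewrite /regression /Rintegral integralE.
apply: (measurableT_comp (fine_measurable _)) => //.
apply: emeasurable_funB; apply: measurable_mixed_kernel_integral => //;
  by [exact: measurable_funepos|exact: measurable_funeneg].
Qed.

(** The positive and negative parts of [Y] are treated separately; their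
conditional means are almost surely finite, so that almost surely the value of
[regression] is the difference of two real numbers. *)
Lemma regression_is_cond_exp : P.-integrable setT (EFin \o Y) ->
  is_cond_exp P cond_pair Y (fun w => regression Pi Pmi (X i w) (Z w)).
Proof.
move=> iY.
have sT : g_sigma_algebra_preimage cond_pair setT.
  exact: (@measurableT _ (g_sigma_algebra_preimageType cond_pair)).
have msub A : g_sigma_algebra_preimage cond_pair A -> measurable A.
  exact: preimage_sigma_algebra_sub.
pose yp : R -> \bar R := (EFin^\+); pose yn : R -> \bar R := (EFin^\-).
have myp : measurable_fun setT yp by exact: measurable_funepos.
have myn : measurable_fun setT yn by exact: measurable_funeneg.
have yp0 y : 0 <= yp y by exact: funepos_ge0.
have yn0 y : 0 <= yn y by exact: funeneg_ge0.
pose p xz := \int[mixed_kernel Pi Pmi xz.1 xz.2]_y yp y.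
pose n xz := \int[mixed_kernel Pi Pmi xz.1 xz.2]_y yn y.
have mp : measurable_fun setT p by exact: measurable_mixed_kernel_integral.
have mn : measurable_fun setT n by exact: measurable_mixed_kernel_integral.
have p0 xz : 0 <= p xz by exact: integral_ge0.
have n0 xz : 0 <= n xz by exact: integral_ge0.
have intp A : g_sigma_algebra_preimage cond_pair A ->
    \int[P]_(w in A) (EFin \o Y)^\+ w = \int[P]_(w in A) p (cond_pair w).
  by move=> sA; rewrite funepos_comp; exact: response_integral myp yp0 sA.
have intn A : g_sigma_algebra_preimage cond_pair A ->
    \int[P]_(w in A) (EFin \o Y)^\- w = \int[P]_(w in A) n (cond_pair w).
  by move=> sA; rewrite funeneg_comp; exact: response_integral myn yn0 sA.
have ip : P.-integrable setT (p \o cond_pair).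
  apply/integrableP; split; first exact: measurableT_comp.
  have <- : \int[P]_w p (cond_pair w) = \int[P]_w `|(p \o cond_pair) w|.
    by apply: eq_integral => w _ /=; apply/esym/gee0_abs.
  by rewrite -intp//; exact: integral_funepos_lt_pinfty.
have iN : P.-integrable setT (n \o cond_pair).
  apply/integrableP; split; first exact: measurableT_comp.
  have <- : \int[P]_w n (cond_pair w) = \int[P]_w `|(n \o cond_pair) w|.
    by apply: eq_integral => w _ /=; apply/esym/gee0_abs.
  by rewrite -intn//; exact: integral_funeneg_lt_pinfty.
pose b xz := fine (p xz - n xz).
have mb : measurable_fun setT b.
  by apply: (measurableT_comp (fine_measurable _)) => //; exact: emeasurable_funB.
have bE x z : regression Pi Pmi x z = b (x, z).
  by rewrite /regression /Rintegral integralE.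
have mbc : measurable_fun setT (EFin \o (fun w => b (cond_pair w))).
  by apply/measurable_EFinP; exact: (measurableT_comp mb).
have bpn : {ae P, forall w,
    (b (cond_pair w))%:E = p (cond_pair w) - n (cond_pair w)}.
  have := integrable_ae measurableT iN; have := integrable_ae measurableT ip.
  apply: filterS2 => w /(_ I) pf /(_ I) nf.
  by rewrite fineK// fin_numB pf nf.
have ipn : P.-integrable setT ((p \o cond_pair) \- (n \o cond_pair)).
  exact: integrableB.
have -> : (fun w => regression Pi Pmi (X i w) (Z w)) = fun w => b (cond_pair w).
  by apply/funext => w; rewrite bE.
have ib : P.-integrable setT (EFin \o (fun w => b (cond_pair w))).
  apply/integrableP; split => //.
  have /integrableP[mpn] := ipn; apply: le_lt_trans.
  rewrite le_eqVlt; apply/orP; left; apply/eqP; apply: ae_eq_integral => //.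
  - exact: measurableT_comp.
  - exact: measurableT_comp.
  - by apply: filterS bpn => w bw _; exact: (congr1 abse bw).
split => //.
  exact: (measurable_comp_preimage_sigma_algebra (W := cond_pair) mb).
move=> A sA; have mA := msub _ sA.
rewrite [RHS]integralE intp// intn//.
rewrite -integralB//; [|exact: (integrableS measurableT)..].
apply: ae_eq_integral => //.
- exact: measurable_funTS.
- by apply: measurable_funTS; exact: measurable_int ipn.
- by apply: filterS bpn => w + _.
Qed.

End regression.

(** * The target parameter *)

Theorem proposition2
  (R : realType) (d : measure_display) (T : measurableType d)
  (P : probability T R)
  (d' : measure_display) (E : measurableType d')
  (Y : {RV P >-> R}) (X : nat -> {RV P >-> R}) (Z : {RV P >-> E})
  (i : nat)
  (Pker : nat -> R.-pker (R * realseq R)%type ~> R)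
  (Pmi : R.-pker E ~> realseq R)
  (b := fun (x : R) (z : E) => regression (Pker i) Pmi x z)
  (beta : R := target P Z (X i) Y) :
  borel_space R E ->
  (* (A1) *)
  (forall j, is_reg_cond_dist P (split_coord X j) Y (Pker j)) ->
  (forall j (x : R),
    \int[distribution P (drop_coord X j)]_u
      \int[Pker j (x, u)]_y `|y|%:E < +oo) ->
  (* (A2) *)
  cond_independent P Z X ->
  g_sigma_algebra_preimage Z `<=`
    \bigcap_j g_sigma_algebra_preimage (drop_coord X j) ->
  (* (A3) *)
  'E_P[fun w => (Y w ^+ 2)%R] < +oo ->
  'E_P[fun w => (X i w ^+ 2)%R] < +oo ->
  0 < 'E_P[cond_var P Z (X i)] ->
  is_reg_cond_dist P Z (drop_coord X i) Pmi ->
  [/\ beta = target P Z (X i) (fun w => b (X i w) (Z w)),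
      (forall x x' z, b x z = b x' z) -> beta = 0%R &
      forall beta' Gamma : E -> R,
        (forall x z, b x z = (beta' z * x + Gamma z)%R) ->
        beta%:E =
        'E_P[fun w => (cond_var P Z (X i) w / fine 'E_P[cond_var P Z (X i)]
                       * beta' (Z w))%R]].
Proof.
have rearrange (x y z : R) : (z * (x * y) = y * z * x)%R.
  by rewrite mulrCA [(z * y)%R]mulrC [RHS]mulrC.
move=> _ Pi_rcd _ indep Zsub EY2 EX2 _ Pmi_rcd.
have Lfun2 (F : {RV P >-> R}) : 'E_P[fun w => (F w ^+ 2)%R] < +oo ->
    (F : T -> R) \in Lfun P 2%:E.
  move=> EF2; apply/Lfun2P; split=> //; apply/integrableP; split.
    by apply/measurable_EFinP; exact: measurable_funX.
  move: EF2; rewrite unlock; apply: le_lt_trans.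
  by under eq_integral do rewrite gee0_abs ?lee_fin ?sqr_ge0//.
have Y2 := Lfun2 _ EY2; have X2 := Lfun2 _ EX2.
have iY : P.-integrable setT (EFin \o Y).
  by apply/Lfun1_integrable; apply: Lfun_subset12 => //; exact: fin_num_measure.
pose V : {mfun T >-> (R * E)%type} := cond_pair Z X i.
have ZV : g_sigma_algebra_preimage Z `<=` g_sigma_algebra_preimage V.
  move=> _ [D mD <-]; exists (snd @^-1` D) => //.
  by rewrite -[X in measurable X]setTI; exact: measurable_snd.
have Zdrop : g_sigma_algebra_preimage Z `<=`
    g_sigma_algebra_preimage (drop_coord X i).
  by move=> A /Zsub; exact.
pose B w := b (X i w) (Z w).
have YB : is_cond_exp P V Y B.
  exact: regression_is_cond_exp.
have B2 : B \in Lfun P 2%:E by exact: cond_exp_Lfun2 YB Y2.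
have mXV : measurable_fun (setT : set (g_sigma_algebra_preimageType V)) (X i).
  exact: (measurable_comp_preimage_sigma_algebra (W := V) measurable_fst).
have covE : cond_cov P Z (X i) B = cond_cov P Z (X i) Y.
  exact: cond_cov_tower ZV mXV X2 Y2 YB.
have affine beta' Gamma : (forall x z, b x z = (beta' z * x + Gamma z)%R) ->
    beta%:E = 'E_P[fun w => (cond_var P Z (X i) w /
      fine 'E_P[cond_var P Z (X i)] * beta' (Z w))%R].
  move=> bE.
  have mb x : measurable_fun setT (b x).
    exact: (measurable_fun_pair2 x (measurable_regression (Pker i) Pmi)).
  have mGamma : measurable_fun setT Gamma.
    have -> : Gamma = b 0%R by apply/funext => z; rewrite bE mulr0 add0r.
    exact: mb.
  have mbeta : measurable_fun setT beta'.
    have -> : beta' = (fun z => b 1%R z - b 0%R z)%R.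
      by apply/funext => z; rewrite !bE mulr1 mulr0 add0r addrK.
    exact: measurable_funB (mb 1%R) (mb 0%R).
  have [ibV covV] := cond_cov_affine X2 B2
    (measurable_comp_preimage_sigma_algebra (W := Z) mbeta)
    (measurable_comp_preimage_sigma_algebra (W := Z) mGamma)
    (fun w => bE (X i w) (Z w)).
  pose c := fine 'E_P[cond_var P Z (X i)].
  have numE : 'E_P[cond_cov P Z (X i) Y] =
      \int[P]_w (beta' (Z w) * cond_var P Z (X i) w)%:E.
    by rewrite -covE unlock; exact: covV.
  have -> : beta =
      (fine (\int[P]_w (beta' (Z w) * cond_var P Z (X i) w)%:E) / c)%R.
    exact: (congr1 (fun u => fine u / c)%R numE).
  rewrite -/c.
  rewrite mulrC EFinM fineK; last exact: integrable_fin_num.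
  transitivity (\int[P]_w ((c^-1)%:E * (beta' (Z w) * cond_var P Z (X i) w)%:E)).
    by rewrite [RHS](integralZl measurableT ibV).
  rewrite unlock; apply: eq_integral => w _.
  exact: (congr1 EFin (rearrange _ _ _)).
split; last exact: affine.
  exact: (congr1 (fun C => fine 'E_P[C] / fine 'E_P[cond_var P Z (X i)])%R
    (esym covE)).
move=> bx; have bE x z : (b x z = cst 0 z * x + b 0 z)%R.
  by rewrite mul0r add0r; exact: bx.
have := affine _ _ bE; rewrite unlock integral0_eq => [[]//|w _].
by rewrite mulr0.
Qed.
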